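(* Let $\mathcal{P}2$ be the downlink total transmit power minimization problem $$\mathcal{P}2:\quad \min_{\mathbf{w}_{i,u},\ \forall i,u}\ \alpha\sum_{i,u}\mathbf{w}_{i,u}^H\mathbf{w}_{i,u}\quad\text{s.t.}\quad \Gamma^{\rm dl}_{i,u}\ \ge\ \gamma_{i,u}\quad\forall i,u,$$ where $\Gamma^{\rm dl}_{i,u}$ is the quantized downlink SINR defined in the context. Then there is no duality gap between $\mathcal{P}2$ and its Lagrangian dual, i.e. the optimal value of $\mathcal{P}2$ equals the optimal value of its Lagrangian dual problem.
   Context: Setting. $N_c,N_u,N_b$ are positive integers (numbers of cells, users per cell, antennas per base station). Indices: $i,j\in\{1,\dots,N_c\}$, $u,v\in\{1,\dots,N_u\}$; $\sum_{i,u}$ is the sum over all such pairs. The channels $\mathbf{h}_{i,j,u}\in\mathbb{C}^{N_b}$ (between base station $i$ and user $u$ of cell $j$) are given. The quantizer gain is $\alpha\in(0,1]$ and $\beta=1-\alpha$. The target SINRs are $\gamma_{i,u}>0$. For a square matrix $\mathbf{A}$, $\mathrm{diag}(\mathbf{A})$ is the diagonal matrix with the same diagonal entries as $\mathbf{A}$. Downlink. The precoder of base station $i$ is $\mathbf{W}_i=[\mathbf{w}_{i,1},\dots,\mathbf{w}_{i,N_u}]\in\mathbb{C}^{N_b\times N_u}$, the quantization noise covariance is $\mathbf{C}_{\mathbf{q}^{\rm dl}_i\mathbf{q}^{\rm dl}_i}=\alpha\beta\,\mathrm{diag}(\mathbf{W}_i\mathbf{W}_i^H)$, and $$\Gamma^{\rm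 dl}_{i,u}=\frac{\alpha^2|\mathbf{w}_{i,u}^H\mathbf{h}_{i,i,u}|^2}{\alpha^2\sum_{(j,v)\ne(i,u)}|\mathbf{w}_{j,v}^H\mathbf{h}_{j,i,u}|^2+\sum_{j=1}^{N_c}\mathbf{h}_{j,i,u}^H\mathbf{C}_{\mathbf{q}^{\rm dl}_j\mathbf{q}^{\rm dl}_j}\mathbf{h}_{j,i,u}+1}.$$ Lagrangian dual of the downlink problem. The SINR constraint of user $(i,u)$ is written in the equivalent form $c_{i,u}(\mathbf{W})\ge 0$ with $$c_{i,u}(\mathbf{W})=\frac{\alpha^2}{\gamma_{i,u}}|\mathbf{w}_{i,u}^H\mathbf{h}_{i,i,u}|^2-\alpha^2\sum_{(j,v)\ne(i,u)}|\mathbf{w}_{j,v}^H\mathbf{h}_{j,i,u}|^2-\sum_{j}\mathbf{h}_{j,i,u}^H\mathbf{C}_{\mathbf{q}^{\rm dl}_j\mathbf{q}^{\rm dl}_j}\mathbf{h}_{j,i,u}-1,$$ the Lagrangian is $\mathcal{L}=\alpha\sum_{i,u}\mathbf{w}_{i,u}^H\mathbf{w}_{i,u}-\sum_{i,u}\mu_{i,u}c_{i,u}(\mathbf{W})$ with multipliers $\mu_{i,u}\ge0$, and the Lagrangian dual is $\max_{\mu_{i,u}\ge0}\ \min_{\{\mathbf{w}_{i,u}\}}\mathcal{L}$. Optimal values are understood in $[0,+\infty]$ (an infeasible minimization problem has value $+\infty$; min and max of values are understood as inf and sup). *)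

(* Defs.v *)
From mathcomp Require Import all_boot all_order all_algebra.
From mathcomp Require Import spectral.
From mathcomp Require Import complex.
From mathcomp Require Import boolp classical_sets reals constructive_ereal ereal.

Set Implicit Arguments.
Unset Strict Implicit.
Unset Printing Implicit Defensive.

Import Order.TTheory GRing.Theory Num.Theory.
Import ComplexField.

Local Open Scope classical_set_scope.
Local Open Scope complex_scope.
Local Open Scope ring_scope.
Local Open Scope sesquilinear_scope.

(* [h i j u] is the channel between base station i and user u of cell j. *)
Definition channels (R : realType) (Nc Nu Nb : nat) : Type :=
  'I_Nc -> 'I_Nc -> 'I_Nu -> 'cV[R[i]]_Nb.

Definition precoders (R : realType) (Nc Nu Nb : nat) : Type :=
  'I_Nc -> 'M[R[i]]_(Nb, Nu).

Definition beam (R : realType) (Nc Nu Nb : nat) (W : precoders R Nc Nu Nb)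
    (i : 'I_Nc) (u : 'I_Nu) : 'cV[R[i]]_Nb :=
  col u (W i).

Definition inner (R : realType) (n : nat) (x y : 'cV[R[i]]_n) : R[i] :=
  (x ^t* *m y) 0 0.

Definition sqmod (R : realType) (z : R[i]) : R := Normc.normc z ^+ 2.

Definition diag_part (K : pzSemiRingType) (n : nat) (A : 'M[K]_n) : 'M[K]_n :=
  diag_mx (\row_k A k k).

Section Downlink.
Context {R : realType} {Nc Nu Nb : nat}.
Implicit Types (alpha : R) (gamma mu : 'I_Nc -> 'I_Nu -> R).
Implicit Types (h : channels R Nc Nu Nb) (W : precoders R Nc Nu Nb).

Definition quant_cov alpha W (j : 'I_Nc) : 'M[R[i]]_Nb :=
  (alpha * (1 - alpha))%:C *: diag_part (W j *m (W j) ^t*).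

Definition interference h W (i : 'I_Nc) (u : 'I_Nu) : R :=
  \sum_(jv : 'I_Nc * 'I_Nu | jv != (i, u))
    sqmod (inner (beam W jv.1 jv.2) (h jv.1 i u)).

(* The form is real-valued, the covariance being Hermitian, so that taking the
   real part only changes its type. *)
Definition quant_noise alpha h W (i : 'I_Nc) (u : 'I_Nu) : R :=
  \sum_(j < Nc)
    complex.Re (inner (h j i u) (quant_cov alpha W j *m h j i u)).

Definition sinr alpha h W (i : 'I_Nc) (u : 'I_Nu) : R :=
  (alpha ^+ 2 * sqmod (inner (beam W i u) (h i i u))) /
  (alpha ^+ 2 * interference h W i u + quant_noise alpha h W i u + 1).

(* [inner w w] is real. *)
Definition total_power alpha W : R :=
  alpha * \sum_(i < Nc) \sum_(u < Nu)
    complex.Re (inner (beam W i u) (beam W i u)).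

Definition feasible alpha gamma h : set (precoders R Nc Nu Nb) :=
  [set W | forall i u, gamma i u <= sinr alpha h W i u].

Definition primal_value alpha gamma h : \bar R :=
  ereal_inf [set (total_power alpha W)%:E | W in feasible alpha gamma h].

Definition slack alpha gamma h W (i : 'I_Nc) (u : 'I_Nu) : R :=
  alpha ^+ 2 / gamma i u * sqmod (inner (beam W i u) (h i i u))
  - alpha ^+ 2 * interference h W i u - quant_noise alpha h W i u - 1.

Definition lagrangian alpha gamma h mu W : R :=
  total_power alpha W
  - \sum_(i < Nc) \sum_(u < Nu) mu i u * slack alpha gamma h W i u.

Definition dual_function alpha gamma h mu : \bar R :=
  ereal_inf [set (lagrangian alpha gamma h mu W)%:E | W in setT].

Definition dual_value alpha gamma h : \bar R :=
  ereal_sup [set dual_function alpha gamma h mu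
            | mu in [set mu : 'I_Nc -> 'I_Nu -> R | forall i u, 0 <= mu i u]].

End Downlink.

(* Main.v *)
(* A multiplier mu is dual feasible iff, for every user k = (i, u),
     mu_k (alpha^2 / gamma_k) |w^H h_k|^2 <= N_k(mu, w)  for all w,
   where N_k(mu, w) = w^H A_k w is positive definite, affine and nondecreasing
   in mu; the dual value is the supremum of sum mu over these mu.  If that set
   is unbounded, weak duality makes both values infinite.  Otherwise
   monotonicity puts its coordinatewise supremum mu* in the set, and by
   maximality each constraint is tight along the beam v_k = A_k^-1 h_k.  The
   matrix S_kl giving the contribution of v_k to the slack of user l has
   nonpositive off-diagonal entries and satisfies S mu* = (alpha |v_k|^2)_k > 0,
   so it is an M-matrix and p S = 1 has a solution p >= 0.  The beams
   sqrt(p_k) v_k meet all SINR constraints with equality, with total power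
   p S mu* = sum mu*. *)
Require Import Defs.
From mathcomp Require Import all_boot all_order all_algebra.
From mathcomp Require Import spectral complex ring lra.
From mathcomp Require Import boolp classical_sets reals constructive_ereal ereal.

Set Implicit Arguments.
Unset Strict Implicit.
Unset Printing Implicit Defensive.

Import Order.TTheory GRing.Theory Num.Theory.
Import ComplexField.

Local Open Scope classical_set_scope.
Local Open Scope ring_scope.

(** * Z-matrices that map some positive vector to a positive vector *)

Section ZMatrix.
Variables (R : realFieldType) (n : nat) (B : 'M[R]_n) (x : 'I_n -> R).
Hypothesis B_le0 : forall k l, k != l -> B k l <= 0.
Hypothesis x_gt0 : forall k, 0 < x k.
Hypothesis Bx_gt0 : forall k, 0 < \sum_l B k l * x l.

(** If the least ratio [r k = y k / x k] were negative, row [k] of [B (y - r k x)] would be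
    positive. But its diagonal term vanishes, and each other term is a nonpositive entry times a
    nonnegative number. *)
Lemma zmatrix_monotone (y : 'I_n -> R) :
  (forall k, 0 <= \sum_l B k l * y l) -> forall k, 0 <= y k.
Proof.
move=> By_ge0 k0; rewrite leNgt; apply/negP => yk0_lt0.
pose r k := y k / x k.
case: (@arg_minP _ _ _ k0 xpredT r isT) => k _ kmin.
have rk_lt0 : r k < 0.
  by apply: le_lt_trans (kmin k0 isT) _; rewrite /r pmulr_llt0 ?invr_gt0.
have : 0 < \sum_l B k l * (y l - r k * x l).
  have -> : \sum_l B k l * (y l - r k * x l) =
            \sum_l B k l * y l - r k * \sum_l B k l * x l.
    by rewrite mulr_sumr -sumrB; apply: eq_bigr => l _; ring.
  have : 0 < - r k * \sum_l B k l * x l by rewrite mulr_gt0 // oppr_gt0.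
  by have := By_ge0 k; lra.
apply/negP; rewrite -leNgt; apply: sumr_le0 => l _.
have [<-|kl] := eqVneq k l; first by rewrite /r divfK ?gt_eqF // subrr mulr0.
by rewrite mulr_le0_ge0 ?B_le0 // subr_ge0 -ler_pdivlMr // kmin.
Qed.

(** Monotonicity applied to a kernel vector and to its opposite forces it to be 0. *)
Lemma zmatrix_unit : B \in unitmx.
Proof.
rewrite -unitmx_tr -row_free_unit; apply: inj_row_free => v vB0.
have vBk k : \sum_l B k l * v 0 l = 0.
  transitivity ((v *m B^T) 0 k); last by rewrite vB0 mxE.
  by rewrite mxE; apply: eq_bigr => l _; rewrite !mxE mulrC.
apply/rowP => k; rewrite mxE; apply/eqP; rewrite eq_le -oppr_ge0.
apply/andP; split; last by apply: zmatrix_monotone => l; rewrite vBk.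
apply: (zmatrix_monotone (y := fun l => - v 0 l)) => l.
by rewrite (eq_bigr _ (fun i _ => mulrN _ _)) sumrN vBk oppr0.
Qed.

Lemma zmatrix_left_solution :
  exists p : 'I_n -> R,
    (forall k, 0 <= p k) /\ (forall l, \sum_k p k * B k l = 1).
Proof.
(* The witness collects the column sums of the inverse of [B]. Each column is nonnegative by
   monotonicity, since [B] maps it to a unit vector. *)
exists (fun k => (const_mx 1 *m invmx B : 'rV_n) 0 k); split=> [k|l].
  rewrite mxE; apply: sumr_ge0 => j _; rewrite mxE mul1r.
  apply: (zmatrix_monotone (y := fun j => invmx B j k)) => l.
  have := congr1 (fun M : 'M_n => M l k) (mulmxV zmatrix_unit).
  by rewrite !mxE => ->; rewrite ler0n.
have := congr1 (fun M : 'rV_n => M 0 l) (mulmxKV zmatrix_unit (const_mx 1)).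
by rewrite [in LHS]mxE [in RHS]mxE.
Qed.

End ZMatrix.

Lemma zmatrix_left_solution_fin (R : realFieldType) (K : finType)
    (B : K -> K -> R) (x : K -> R) :
  (forall k l, k != l -> B k l <= 0) -> (forall k, 0 < x k) ->
  (forall k, 0 < \sum_l B k l * x l) ->
  exists p : K -> R,
    (forall k, 0 <= p k) /\ (forall l, \sum_k p k * B k l = 1).
Proof.
move=> B_le0 x_gt0 Bx_gt0.
have sumE (F : K -> R) : \sum_k F k = \sum_(i < #|K|) F (enum_val i).
  by rewrite (reindex _ (onW_bij _ (@enum_val_bij K))).
have [|||p [p_ge0 pB]] := @zmatrix_left_solution R #|K|
    (\matrix_(i, j) B (enum_val i) (enum_val j)) (fun i => x (enum_val i)).
- by move=> k l kl; rewrite mxE B_le0 // (inj_eq enum_val_inj).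
- by [].
- move=> k; under eq_bigr do rewrite mxE.
  rewrite -(sumE (fun l => B (enum_val k) l * x l)).
  exact: Bx_gt0.
exists (p \o enum_rank); split=> [k|l]; first exact: p_ge0.
rewrite sumE -[RHS](pB (enum_rank l)); apply: eq_bigr => i _.
by rewrite mxE /= enum_valK enum_rankK.
Qed.

(** * Attainment of the dual bound for abstract quadratic forms *)

Section AbstractBeamforming.
Variables (R : realType) (K : finType) (V : Type).
(* [e] is the power of a beam, [a k] the gain of the useful signal of user [k],
   [b k l] the noise that the beam of user [k] causes to user [l], and [g] the
   weight of the useful signal in the constraints. *)
Variables (e : V -> R) (a : K -> V -> R) (b : K -> K -> V -> R) (g : K -> R).
Variable scale : R -> V -> V.

(** Total cost of giving beam [w] to user [k]: its power plus the noise inflicted on each user,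
    priced by the multipliers. *)
Definition noise_form (mu : K -> R) k w := e w + \sum_l mu l * b k l w.

Definition dual_set : set (K -> R) :=
  [set mu | (forall k, 0 <= mu k) /\
            (forall k w, mu k * g k * a k w <= noise_form mu k w)].

Hypotheses (e_ge0 : forall w, 0 <= e w) (a_ge0 : forall k w, 0 <= a k w)
  (b_ge0 : forall k l w, 0 <= b k l w) (g_gt0 : forall k, 0 < g k).
Hypotheses
  (eZ : forall p w, 0 <= p -> e (scale p w) = p * e w)
  (aZ : forall k p w, 0 <= p -> a k (scale p w) = p * a k w)
  (bZ : forall k l p w, 0 <= p -> b k l (scale p w) = p * b k l w).
(* The vector [v] is the one representing the channel of user [k] with respect
   to the positive definite form [noise_form mu k]. *)
Hypothesis riesz : forall mu k, (forall l, 0 <= mu l) ->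
  exists2 v, a k v = noise_form mu k v ^+ 2 /\
             (0 < noise_form mu k v -> 0 < e v)
  & forall w, a k w <= noise_form mu k v * noise_form mu k w.

Lemma noise_form_ge0 mu k w : (forall l, 0 <= mu l) -> 0 <= noise_form mu k w.
Proof.
by move=> mu0; rewrite addr_ge0 // sumr_ge0 // => l _; rewrite mulr_ge0.
Qed.

Lemma noise_form_le mu nu k w :
  (forall l, mu l <= nu l) -> noise_form mu k w <= noise_form nu k w.
Proof.
move=> le_mu; rewrite lerD2l; apply: ler_sum => l _.
by rewrite ler_wpM2r.
Qed.

Lemma dual_set0 : dual_set (fun=> 0).
Proof.
split=> // k w; rewrite !mul0r.
exact: noise_form_ge0.
Qed.

(** [M] stands for a finite dual value. *)
Variable M : R.
Hypothesis dual_setM : forall mu, dual_set mu -> \sum_k mu k <= M.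

Definition dual_top (k : K) : R := sup [set mu k | mu in dual_set].

Lemma dual_set_coord mu k : dual_set mu -> mu k <= M.
Proof.
move=> Dmu; apply: le_trans (dual_setM Dmu); rewrite (bigD1 k) //= lerDl.
by apply: sumr_ge0 => l _; case: Dmu.
Qed.

Lemma dual_top_has_sup k : has_sup [set mu k | mu in dual_set].
Proof.
split; first by exists 0, (fun=> 0) => //; exact: dual_set0.
by exists M => _ [mu Dmu <-]; exact: dual_set_coord.
Qed.

Lemma dual_top_ge mu k : dual_set mu -> mu k <= dual_top k.
Proof.
by move=> Dmu; apply: sup_upper_bound (dual_top_has_sup k) _ _; exists mu.
Qed.

Lemma dual_top_ge0 k : 0 <= dual_top k.
Proof. exact: (dual_top_ge k dual_set0). Qed.

(* [noise_form] is monotone in the multipliers, so [dual_set] is closed under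
   coordinatewise suprema. *)
Lemma dual_top_in : dual_set dual_top.
Proof.
split=> [k|k w]; first exact: dual_top_ge0.
have ga_ge0 : 0 <= g k * a k w by rewrite mulr_ge0 // ltW.
apply/ler_addgt0Pr => eps eps_gt0; rewrite -mulrA.
(* The added 1 keeps the denominator positive when the gain is 0. *)
pose d := eps / (g k * a k w + 1).
have d_gt0 : 0 < d by rewrite divr_gt0 // ltr_wpDl.
have [_ [mu Dmu <-] lt_mu] := sup_adherent d_gt0 (dual_top_has_sup k).
have le1 : noise_form mu k w <= noise_form dual_top k w.
  by apply: noise_form_le => l; exact: dual_top_ge.
have := Dmu.2 k w; rewrite -mulrA => le2.
have le3 : dual_top k * (g k * a k w) <= (mu k + d) * (g k * a k w).
  by rewrite ler_wpM2r // -lerBlDr ltW.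
have le4 : d * (g k * a k w) <= eps.
  by rewrite /d mulrAC ler_pdivrMr ?ltr_wpDl // ler_wpM2l ?(ltW eps_gt0) // lerDl.
by move: le3; rewrite mulrDl; lra.
Qed.

(** The Riesz vector [v] maximizes gain over noise, so slack at [v] would be slack for every beam of
    user [k]. Coordinate [k] could then be raised inside [dual_set], against the choice of
    [dual_top]. *)
Lemma dual_top_tight k : exists v,
  [/\ a k v = noise_form dual_top k v ^+ 2, 0 < e v &
      dual_top k * g k * noise_form dual_top k v = 1].
Proof.
have [v [av ev] vmax] := riesz k dual_top_ge0; exists v.
set s := noise_form _ k v in av ev vmax *.
have s_ge0 : 0 <= s by apply: noise_form_ge0; exact: dual_top_ge0.
suff tight : dual_top k * g k * s = 1.
  split=> //; apply: ev; rewrite lt_def s_ge0 andbT.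
  apply/eqP => s0; move: tight; rewrite s0 mulr0 => /eqP.
  by rewrite eq_sym oner_eq0.
have [Dge0 Dle] := dual_top_in.
apply/eqP; rewrite eq_le; apply/andP; split.
  have [->|s_neq0] := eqVneq s 0; first by rewrite mulr0.
  have s_gt0 : 0 < s by rewrite lt_def s_neq0.
  have := Dle k v; rewrite av -/s expr2 mulrA -{3}[s]mul1r.
  by rewrite ler_pM2r.
rewrite leNgt; apply/negP => lt1.
(* Chosen so that [(dual_top k + d) * g k * s <= 1]; using [s + 1] also covers [s = 0]. *)
pose d := (1 - dual_top k * g k * s) / (g k * (s + 1)).
have gs_gt0 : 0 < g k * (s + 1) by rewrite mulr_gt0 // ltr_wpDl.
have d_gt0 : 0 < d by rewrite divr_gt0 // subr_gt0.
pose nu l := dual_top l + (if l == k then d else 0).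
have nu_ge l : dual_top l <= nu l by rewrite lerDl; case: ifP => // _; exact: ltW.
have nu_ge0 l : 0 <= nu l by exact: le_trans (nu_ge l).
(* Raising coordinate [k] only increases the noise side for the other users; for user [k] the bound
   [vmax] reduces all beams to [v]. *)
have Dnu : dual_set nu.
  split=> // l w; apply: le_trans (noise_form_le l w nu_ge).
  rewrite /nu; have [->|_] := eqVneq l k; last by rewrite addr0.
  have N_ge0 : 0 <= noise_form dual_top k w by apply: noise_form_ge0.
  have c_ge0 : 0 <= (dual_top k + d) * g k.
    by rewrite mulr_ge0 ?addr_ge0 // ltW.
  apply: le_trans (ler_wpM2l c_ge0 (vmax w)) _.
  rewrite mulrA -[leRHS]mul1r ler_wpM2r //.
  have : d * (g k * s) <= 1 - dual_top k * g k * s.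
    rewrite /d mulrAC ler_pdivrMr // ler_wpM2l ?subr_ge0 ?(ltW lt1) //.
    by rewrite ler_pM2l // lerDl.
  by rewrite !mulrDl mulrA; lra.
have := dual_top_ge k Dnu; rewrite /nu eqxx.
by rewrite leNgt ltrDl d_gt0.
Qed.

Lemma dual_attained : exists W : K -> V,
  (forall l, g l * a l (W l) - \sum_k b k l (W k) = 1) /\
  \sum_k e (W k) = \sum_k dual_top k.
Proof.
have [v vP] : exists v : K -> V, forall k,
    [/\ a k (v k) = noise_form dual_top k (v k) ^+ 2, 0 < e (v k) &
      dual_top k * g k * noise_form dual_top k (v k) = 1].
  by have /choice[v vP] := dual_top_tight; exists v.
pose S k l := (if k == l then g k * a k (v k) else 0) - b k l (v k).
(* By tightness the weighted signal term equals [noise_form dual_top k (v k)]; its noise part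
   cancels and the power remains. *)
have sumS k : \sum_l S k l * dual_top l = e (v k).
  have [av _ tight] := vP k.
  under eq_bigr do rewrite mulrBl; rewrite sumrB (bigD1 k) //= eqxx big1 ?addr0.
    have : noise_form dual_top k (v k) =
           e (v k) + \sum_l b k l (v k) * dual_top l.
      by congr (_ + _); apply: eq_bigr => l _; rewrite mulrC.
    rewrite av; move: tight; set s := noise_form _ _ _ => tight sE.
    have -> : g k * s ^+ 2 * dual_top k = dual_top k * g k * s * s by ring.
    by rewrite tight mul1r sE; ring.
  by move=> l; rewrite eq_sym => /negbTE ->; rewrite mul0r.
have [k l kl|k|k|p [p_ge0 pS]] := zmatrix_left_solution_fin (B := S) (x := dual_top).
- by rewrite /S (negbTE kl) sub0r oppr_le0.
- have [_ _ tight] := vP k; rewrite lt_def dual_top_ge0 andbT.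
  apply/eqP => t0; move: tight; rewrite t0 !mul0r => /eqP.
  by rewrite eq_sym oner_eq0.
- by rewrite sumS; have [] := vP k.
exists (fun k => scale (p k) (v k)); split=> [l|].
  rewrite aZ // -[RHS](pS l) /S.
  under [in RHS]eq_bigr do rewrite mulrBr; rewrite sumrB; congr (_ - _).
    rewrite (bigD1 l) //= eqxx big1 ?addr0; first by rewrite mulrCA.
    by move=> k /negbTE ->; rewrite mulr0.
  by apply: eq_bigr => k _; rewrite bZ.
(* The double sum is evaluated twice: summing over [l] first gives the power, summing over [k] first
   gives the sum of the multipliers. *)
transitivity (\sum_k \sum_l p k * S k l * dual_top l).
  apply: eq_bigr => k _; rewrite eZ // -sumS mulr_sumr.
  by apply: eq_bigr => l _; rewrite mulrA.
rewrite exchange_big; apply: eq_bigr => l _ /=.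
by rewrite -mulr_suml pS mul1r.
Qed.

End AbstractBeamforming.

(** * Hermitian forms on complex vectors *)

Section HermitianForms.
Variable R : realType.
Local Open Scope complex_scope.
Local Open Scope sesquilinear_scope.

Lemma sqmod_ge0 (z : R[i]) : 0 <= sqmod z.
Proof. exact: exprn_even_ge0. Qed.

Lemma sqmodE (z : R[i]) : (sqmod z)%:C = z * Num.conj z.
Proof. by rewrite -normCK rmorphXn. Qed.

Lemma sqmod_eq0 (z : R[i]) : sqmod z = 0 -> z = 0.
Proof. by move/eqP; rewrite expf_eq0 /= => /eqP/Normc.eq0_normc. Qed.

Lemma sqmodM (y z : R[i]) : sqmod (y * z) = sqmod y * sqmod z.
Proof. by rewrite /sqmod Normc.normcM exprMn. Qed.

Lemma sqmod_real (r : R) : sqmod r%:C = r ^+ 2.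
Proof.
apply: (@complexI R); rewrite sqmodE rmorphXn expr2 conj_Creal //.
by apply/complex_realP; exists r.
Qed.

Lemma conj_real (r : R) : Num.conj r%:C = r%:C.
Proof. by apply: conj_Creal; apply/complex_realP; exists r. Qed.

Variable n : nat.
Implicit Types (A B : 'M[R[i]]_n) (f : 'cV[R[i]]_n -> R).
Implicit Types (x y v w : 'cV[R[i]]_n).

Lemma innerE x y : inner x y = \sum_m Num.conj (x m 0) * y m 0.
Proof. by rewrite /inner mxE; apply: eq_bigr => m _; rewrite !mxE. Qed.

Lemma innerDr x y1 y2 : inner x (y1 + y2) = inner x y1 + inner x y2.
Proof. by rewrite /inner mulmxDr mxE. Qed.

Lemma innerZr x c y : inner x (c *: y) = c * inner x y.
Proof. by rewrite /inner -scalemxAr mxE. Qed.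

Lemma inner_sumr (I : finType) x (F : I -> 'cV_n) :
  inner x (\sum_i F i) = \sum_i inner x (F i).
Proof. by rewrite /inner mulmx_sumr summxE. Qed.

Lemma conj_inner x y : Num.conj (inner x y) = inner y x.
Proof.
rewrite !innerE rmorph_sum; apply: eq_bigr => m _.
by rewrite rmorphM /= conjCK mulrC.
Qed.

Lemma innerDl x1 x2 y : inner (x1 + x2) y = inner x1 y + inner x2 y.
Proof. by rewrite -conj_inner innerDr rmorphD /= !conj_inner. Qed.

Lemma innerZl x c y : inner (c *: x) y = Num.conj c * inner x y.
Proof. by rewrite -conj_inner innerZr rmorphM /= conj_inner. Qed.

Lemma inner_self x : inner x x = (\sum_m sqmod (x m 0))%:C.
Proof.
rewrite innerE rmorph_sum; apply: eq_bigr => m _.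
by rewrite /= sqmodE mulrC.
Qed.

(** The values of the form are carried by a real function [f], so that they can be compared in
    [R]. *)
Definition herm_form A f :=
  (forall x y, inner (A *m x) y = inner x (A *m y)) /\
  (forall w, inner w (A *m w) = (f w)%:C).

Lemma herm_formD A B f f' :
  herm_form A f -> herm_form B f' -> herm_form (A + B) (fun w => f w + f' w).
Proof.
move=> [Ah Af] [Bh Bf]; split=> [x y|w].
  by rewrite !mulmxDl innerDl innerDr Ah Bh.
by rewrite mulmxDl innerDr Af Bf rmorphD.
Qed.

Lemma herm_formZ (c : R) A f :
  herm_form A f -> herm_form (c%:C *: A) (fun w => c * f w).
Proof.
move=> [Ah Af]; split=> [x y|w].
  by rewrite -!scalemxAl innerZl innerZr conj_real Ah.
by rewrite -scalemxAl innerZr Af rmorphM.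
Qed.

Lemma herm_form_sum (I : finType) (A : I -> 'M_n) (f : I -> 'cV_n -> R) :
  (forall i, herm_form (A i) (f i)) ->
  herm_form (\sum_i A i) (fun w => \sum_i f i w).
Proof.
move=> Af; split=> [x y|w]; rewrite !mulmx_suml.
  rewrite -conj_inner !inner_sumr rmorph_sum; apply: eq_bigr => i _.
  by rewrite /= conj_inner (Af i).1.
by rewrite inner_sumr rmorph_sum; apply: eq_bigr => i _; rewrite (Af i).2.
Qed.

Lemma herm_form1 : herm_form 1%:M (fun w => complex.Re (inner w w)).
Proof. by split=> [x y|w]; rewrite !mul1mx // inner_self. Qed.

Lemma herm_form_rank1 x : herm_form (x *m x ^t*) (fun w => sqmod (inner w x)).
Proof.
have xE w : x *m x ^t* *m w = inner x w *: x.
  rewrite -mulmxA [x ^t* *m w]mx11_scalar mul_mx_scalar.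
  by [].
split=> [y z|w]; rewrite !xE innerZr.
  by rewrite innerZl conj_inner mulrC.
by rewrite sqmodE conj_inner mulrC.
Qed.

Lemma herm_form_diag x :
  herm_form (diag_mx (\row_m (sqmod (x m 0))%:C))
    (fun w => \sum_m sqmod (w m 0) * sqmod (x m 0)).
Proof.
have dE w m : (diag_mx (\row_m (sqmod (x m 0))%:C) *m w) m 0 =
    (sqmod (x m 0))%:C * w m 0 by rewrite mul_diag_mx !mxE.
split=> [y z|w]; rewrite !innerE ?rmorph_sum; apply: eq_bigr => m _.
  by rewrite !dE rmorphM /= conj_real mulrA [_ * Num.conj _]mulrC.
by rewrite /= dE [RHS]rmorphM /= (sqmodE (w m 0)); ring.
Qed.

(** With [v] the solution of [A v = h], pairing with [h] is pairing with [v] in the inner product of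
    [A], and the bound is Cauchy-Schwarz. *)
Lemma herm_form_riesz A f h :
  herm_form A f -> (forall w, 0 <= f w) -> (forall w, f w = 0 -> w = 0) ->
  exists2 v, sqmod (inner v h) = f v ^+ 2
  & forall w, sqmod (inner w h) <= f v * f w.
Proof.
move=> [Ah Af] f_ge0 f_eq0.
have A_unit : A \in unitmx.
  rewrite -unitmx_tr -row_free_unit; apply: inj_row_free => v vA0.
  have Av0 : A *m v^T = 0 by rewrite -[A]trmxK -trmx_mul vA0 trmx0.
  suff : v^T = 0 by move/(congr1 trmx); rewrite trmxK trmx0.
  by apply: f_eq0; apply: (@complexI R); rewrite -Af Av0 /inner mulmx0 mxE.
pose v := invmx A *m h.
have Av : A *m v = h by rewrite mulKVmx.
have fv : inner v h = (f v)%:C by rewrite -Av Af.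
exists v => [|w]; first by rewrite fv sqmod_real.
have [fv0|fv_neq0] := eqVneq (f v) 0.
  have h0 : h = 0 by rewrite -Av (f_eq0 _ fv0) mulmx0.
  by rewrite h0 /inner mulmx0 mxE (sqmod_real 0) expr0n mulr_ge0.
(* This [t] minimizes [f (w + t *: v)]; nonnegativity of the minimum is the claim. *)
pose t := - Num.conj (inner w h) / (f v)%:C.
have C0 : (f v)%:C != 0 by rewrite (inj_eq (@complexI R)).
have tz : t * inner w h = - (sqmod (inner w h))%:C / (f v)%:C.
  by rewrite sqmodE /t; field.
have tJ : Num.conj t = - inner w h / (f v)%:C.
  by rewrite /t rmorphM /= rmorphN /= conjCK fmorphV /= conj_real.
have vAw : inner v (A *m w) = Num.conj (inner w h).
  by rewrite conj_inner -Av Ah.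
have : f (w + t *: v) = f w - sqmod (inner w h) / f v.
  apply: (@complexI R); rewrite -Af mulmxDr -scalemxAr Av innerDr !innerDl.
  rewrite !innerZr !innerZl Af vAw fv tz.
  rewrite [RHS]rmorphB /= [in RHS]rmorphM /= fmorphV tJ /t sqmodE.
  by field.
move=> fE; have := f_ge0 (w + t *: v).
rewrite fE subr_ge0 ler_pdivrMr 1?mulrC //.
by rewrite lt_def fv_neq0 f_ge0.
Qed.

End HermitianForms.

(** * The quantized downlink as an instance of the abstract problem *)

Section DownlinkDuality.
Variables (R : realType) (Nc Nu Nb : nat) (h : channels R Nc Nu Nb).
Variables (alpha : R) (gamma : 'I_Nc -> 'I_Nu -> R).
Hypotheses (alpha_gt0 : 0 < alpha) (alpha_le1 : alpha <= 1)
  (gamma_gt0 : forall i u, 0 < gamma i u).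
Local Open Scope complex_scope.
Local Open Scope sesquilinear_scope.

Local Notation user := ('I_Nc * 'I_Nu)%type.
Local Notation vec := 'cV[R[i]]_Nb.
Implicit Types (k l : user) (w : vec) (W : precoders R Nc Nu Nb).

Definition beam_power w : R := alpha * complex.Re (inner w w).

Definition signal k w : R := sqmod (inner w (h k.1 k.1 k.2)).

(* For [k = l] only the quantization noise of the user's own beam remains. *)
Definition cross_noise k l w : R :=
  alpha ^+ 2 * (k != l)%:R * sqmod (inner w (h k.1 l.1 l.2)) +
  alpha * (1 - alpha) * \sum_m sqmod (w m 0) * sqmod (h k.1 l.1 l.2 m 0).

Definition signal_weight k : R := alpha ^+ 2 / gamma k.1 k.2.

(** The square root makes power, signal and noise, all quadratic in the beam, scale by [p]. *)
Definition scale_beam (p : R) w : vec := (Num.sqrt p)%:C *: w.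

Let ab_ge0 : 0 <= alpha * (1 - alpha).
Proof. by rewrite mulr_ge0 ?subr_ge0 // ltW. Qed.

Lemma Re_inner_self w : complex.Re (inner w w) = \sum_m sqmod (w m 0).
Proof. by rewrite inner_self. Qed.

Lemma beam_power_ge0 w : 0 <= beam_power w.
Proof.
rewrite mulr_ge0 ?(ltW alpha_gt0) // Re_inner_self sumr_ge0 // => m _.
exact: sqmod_ge0.
Qed.

Lemma beam_power_eq0 w : beam_power w = 0 -> w = 0.
Proof.
move/eqP; rewrite mulf_eq0 gt_eqF //= Re_inner_self psumr_eq0; last first.
  by move=> m _; exact: sqmod_ge0.
move=> /allP w0; apply/colP => m; rewrite mxE; apply: sqmod_eq0.
by apply/eqP; apply: w0; rewrite mem_index_enum.
Qed.

Lemma signal_ge0 k w : 0 <= signal k w.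
Proof. exact: sqmod_ge0. Qed.

Lemma quant_form_ge0 (x w : vec) :
  0 <= alpha * (1 - alpha) * \sum_m sqmod (w m 0) * sqmod (x m 0).
Proof.
by rewrite mulr_ge0 // sumr_ge0 // => m _; rewrite mulr_ge0 // sqmod_ge0.
Qed.

Lemma cross_noise_ge0 k l w : 0 <= cross_noise k l w.
Proof.
rewrite addr_ge0 ?quant_form_ge0 // mulr_ge0 ?sqmod_ge0 //.
by rewrite mulr_ge0 ?ler0n // sqr_ge0.
Qed.

Lemma signal_weight_gt0 k : 0 < signal_weight k.
Proof. by rewrite divr_gt0 ?exprn_gt0. Qed.

Lemma sqmod_inner_scale p (x w : vec) : 0 <= p ->
  sqmod (inner (scale_beam p w) x) = p * sqmod (inner w x).
Proof.
by move=> p_ge0; rewrite innerZl conj_real sqmodM sqmod_real sqr_sqrtr.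
Qed.

Lemma sqmod_scale p w m : 0 <= p ->
  sqmod (scale_beam p w m 0) = p * sqmod (w m 0).
Proof. by move=> p_ge0; rewrite mxE sqmodM sqmod_real sqr_sqrtr. Qed.

Lemma beam_power_scale p w : 0 <= p ->
  beam_power (scale_beam p w) = p * beam_power w.
Proof.
move=> p_ge0; rewrite /beam_power !Re_inner_self [RHS]mulrCA; congr (_ * _).
by rewrite mulr_sumr; apply: eq_bigr => m _; rewrite sqmod_scale.
Qed.

Lemma signal_scale k p w : 0 <= p ->
  signal k (scale_beam p w) = p * signal k w.
Proof. exact: sqmod_inner_scale. Qed.

Lemma cross_noise_scale k l p w : 0 <= p ->
  cross_noise k l (scale_beam p w) = p * cross_noise k l w.
Proof.
move=> p_ge0; rewrite /cross_noise [RHS]mulrDr; congr (_ + _).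
  by rewrite sqmod_inner_scale // [LHS]mulrCA.
rewrite [RHS]mulrCA; congr (_ * _); rewrite mulr_sumr; apply: eq_bigr => m _.
by rewrite sqmod_scale // -mulrA.
Qed.

Local Notation noise := (noise_form beam_power cross_noise).

(** Power gives a multiple of the identity, interference rank-one matrices, and quantization
    diagonal ones. *)
Lemma noise_herm_form mu k : exists A, herm_form A (noise mu k).
Proof.
pose A l := (alpha ^+ 2 * (k != l)%:R)%:C *:
              (h k.1 l.1 l.2 *m (h k.1 l.1 l.2) ^t*) +
            (alpha * (1 - alpha))%:C *:
              diag_mx (\row_m (sqmod (h k.1 l.1 l.2 m 0))%:C).
exists (alpha%:C *: 1%:M + \sum_l (mu l)%:C *: A l).
apply: herm_formD; first by apply: herm_formZ; exact: herm_form1.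
apply: herm_form_sum => l; apply: herm_formZ; apply: herm_formD.
  by apply: herm_formZ; exact: herm_form_rank1.
by apply: herm_formZ; exact: herm_form_diag.
Qed.

(** The power term alone makes the form positive definite, so the Riesz vector exists for all
    nonnegative multipliers. *)
Lemma noise_riesz mu k : (forall l, 0 <= mu l) ->
  exists2 v, signal k v = noise mu k v ^+ 2 /\
             (0 < noise mu k v -> 0 < beam_power v)
  & forall w, signal k w <= noise mu k v * noise mu k w.
Proof.
move=> mu_ge0; have [A Anoise] := noise_herm_form mu k.
have sum_ge0 w : 0 <= \sum_l mu l * cross_noise k l w.
  by apply: sumr_ge0 => l _; rewrite mulr_ge0 // cross_noise_ge0.
have noise_ge0 w : 0 <= noise mu k w by rewrite addr_ge0 ?beam_power_ge0.
have noise_eq0 w : noise mu k w = 0 -> w = 0.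
  move=> N0; apply: beam_power_eq0; apply/eqP.
  by rewrite eq_le beam_power_ge0 -N0 lerDl sum_ge0.
have [v v1 v2] := herm_form_riesz (h k.1 k.1 k.2) Anoise noise_ge0 noise_eq0.
exists v => //; split=> // N_gt0; rewrite lt_def beam_power_ge0 andbT.
apply/eqP => /beam_power_eq0 v0; move: N_gt0; rewrite v0.
have [_ /(_ 0)] := Anoise; rewrite /inner !mulmx0 mxE => /esym/complexI ->.
by rewrite ltxx.
Qed.

Lemma total_powerE W :
  total_power alpha W = \sum_k beam_power (beam W k.1 k.2).
Proof. by rewrite /total_power pair_bigA mulr_sumr. Qed.

(** The diagonal of [W_j W_j^H] sums the squared moduli of the beam entries, so quantization noise
    splits into one term per beam. *)
Lemma quant_noiseE W l :
  quant_noise alpha h W l.1 l.2 =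
  \sum_k alpha * (1 - alpha) *
    \sum_m sqmod (beam W k.1 k.2 m 0) * sqmod (h k.1 l.1 l.2 m 0).
Proof.
rewrite /quant_noise -(pair_bigA _ (fun j v => alpha * (1 - alpha) *
  \sum_m sqmod (beam W j v m 0) * sqmod (h j l.1 l.2 m 0))) /=.
apply: eq_bigr => j _; rewrite -mulr_sumr exchange_big /=.
(* Once the complex value is exhibited as an embedded real, taking its real part is a
   computation. *)
suff -> : inner (h j l.1 l.2) (quant_cov alpha W j *m h j l.1 l.2) =
   (alpha * (1 - alpha) * \sum_m \sum_v
     sqmod (beam W j v m 0) * sqmod (h j l.1 l.2 m 0))%:C by [].
rewrite /quant_cov -scalemxAl innerZr [RHS]rmorphM; congr (_ * _).
rewrite innerE rmorph_sum; apply: eq_bigr => m _ /=.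
rewrite -mulr_suml [RHS]rmorphM /= sqmodE rmorph_sum /=.
rewrite /diag_part mul_diag_mx !mxE mulrCA; congr (_ * _); last exact: mulrC.
by apply: eq_bigr => v _; rewrite sqmodE !mxE.
Qed.

Lemma quant_noise_ge0 W l : 0 <= quant_noise alpha h W l.1 l.2.
Proof. by rewrite quant_noiseE sumr_ge0 // => k _; exact: quant_form_ge0. Qed.

Lemma interference_ge0 W l : 0 <= interference h W l.1 l.2.
Proof. by apply: sumr_ge0 => k _; exact: sqmod_ge0. Qed.

Lemma slackE W l :
  slack alpha gamma h W l.1 l.2 =
  signal_weight l * signal l (beam W l.1 l.2)
  - \sum_k cross_noise k l (beam W k.1 k.2) - 1.
Proof.
rewrite /slack /cross_noise big_split /= -quant_noiseE.
suff -> : \sum_k alpha ^+ 2 * (k != l)%:R *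
    sqmod (inner (beam W k.1 k.2) (h k.1 l.1 l.2)) =
    alpha ^+ 2 * interference h W l.1 l.2.
  by rewrite /signal_weight /signal; ring.
rewrite /interference mulr_sumr [RHS]big_mkcond; apply: eq_bigr => k _.
rewrite -surjective_pairing; case: eqP => _ /=.
  by rewrite mulr0 mul0r.
by rewrite mulr1.
Qed.

(** The unit thermal noise makes the SINR denominator positive, so it can be cleared. *)
Lemma feasible_slack W :
  feasible alpha gamma h W <->
  forall l, 0 <= slack alpha gamma h W l.1 l.2.
Proof.
have eqv l : (gamma l.1 l.2 <= sinr alpha h W l.1 l.2) =
             (0 <= slack alpha gamma h W l.1 l.2).
  have D_gt0 : 0 < alpha ^+ 2 * interference h W l.1 l.2 +
                   quant_noise alpha h W l.1 l.2 + 1.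
    rewrite ltr_wpDl // addr_ge0 ?quant_noise_ge0 //.
    by rewrite mulr_ge0 ?sqr_ge0 // interference_ge0.
  rewrite /sinr /slack ler_pdivlMr // -!addrA -!opprD subr_ge0 !addrA.
  by rewrite [alpha ^+ 2 / _ * _]mulrAC ler_pdivlMr // mulrC.
by split=> [WF [i u]|Ws i u]; [rewrite -eqv; apply: WF | rewrite (eqv (i, u))].
Qed.

Local Notation dset :=
  (dual_set beam_power signal cross_noise signal_weight).

(** Charging noise to the beam that causes it, instead of the user who receives it, separates the
    Lagrangian into one term per beam. *)
Lemma lagrangianE mu W :
  lagrangian alpha gamma h mu W =
  \sum_l mu l.1 l.2 +
  \sum_k (noise (fun l => mu l.1 l.2) k (beam W k.1 k.2) -
     mu k.1 k.2 * signal_weight k * signal k (beam W k.1 k.2)).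
Proof.
rewrite /lagrangian total_powerE pair_bigA /=.
under [X in _ - X]eq_bigr do rewrite slackE !mulrBr mulr1.
rewrite !sumrB /noise_form big_split /=.
have -> : \sum_l mu l.1 l.2 * (\sum_k cross_noise k l (beam W k.1 k.2)) =
  \sum_k \sum_l mu l.1 l.2 * cross_noise k l (beam W k.1 k.2).
  by rewrite exchange_big; apply: eq_bigr => l _; rewrite mulr_sumr.
under [X in _ - (X - _ - _)]eq_bigr do rewrite mulrA.
by ring.
Qed.

(** On the dual set each beam term of the Lagrangian is nonnegative, which leaves at least the sum
    of the multipliers. *)
Lemma dset_le_dual_value (mu : user -> R) :
  dset mu -> ((\sum_l mu l)%:E <= dual_value alpha gamma h)%E.
Proof.
move=> [mu_ge0 mu_le].
have muE : (fun l => mu (l.1, l.2)) = mu by apply/funext => -[].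
apply: le_trans (ereal_sup_ubound _); last first.
  by exists (fun i u => mu (i, u)) => //= i u; exact: mu_ge0.
apply: le_ereal_inf_tmp => _ [W _ <-]; rewrite lee_fin lagrangianE muE.
under [X in _ <= X + _]eq_bigr do rewrite -surjective_pairing.
rewrite lerDl sumr_ge0 // => k _.
by rewrite subr_ge0 -surjective_pairing mu_le.
Qed.

Lemma weak_duality :
  (dual_value alpha gamma h <= primal_value alpha gamma h)%E.
Proof.
apply: ge_ereal_sup => _ [mu mu_ge0 <-]; apply: le_ereal_inf_tmp => _ [W WF <-].
apply: le_trans (ereal_inf_lbound _) _; first by exists W.
rewrite lee_fin /lagrangian gerBl sumr_ge0 // => i _.
rewrite sumr_ge0 // => u _; rewrite mulr_ge0 ?mu_ge0 //.
by have /feasible_slack/(_ (i, u)) := WF.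
Qed.

Lemma strong_duality :
  (primal_value alpha gamma h <= dual_value alpha gamma h)%E.
Proof.
(* An infinite dual value is either trivial or, for the negative one, excluded by the zero
   multiplier; a finite one bounds the dual set. *)
case dualE : (dual_value alpha gamma h) => [M||]; last 2 first.
- by rewrite leey.
- have := dset_le_dual_value (dual_set0 signal signal_weight
    beam_power_ge0 cross_noise_ge0).
  by rewrite dualE leeNy_eq.
have dsetM mu : dset mu -> \sum_l mu l <= M.
  by move/dset_le_dual_value; rewrite dualE lee_fin.
have [w [slack0 powerE]] := dual_attained beam_power_ge0 signal_ge0
  cross_noise_ge0 signal_weight_gt0 beam_power_scale signal_scale
  cross_noise_scale noise_riesz dsetM.
pose W : precoders R Nc Nu Nb := fun i => \matrix_(m, u) w (i, u) m 0.
have WE k : beam W k.1 k.2 = w k.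
  by apply/colP => m; rewrite !mxE -surjective_pairing.
apply: le_trans (ereal_inf_lbound _) _.
  exists W => //; apply/feasible_slack => l; rewrite slackE WE.
  by under eq_bigr do rewrite WE; rewrite slack0 subrr.
rewrite lee_fin total_powerE; under eq_bigr do rewrite WE.
rewrite powerE; apply: (dsetM _).
exact: (dual_top_in beam_power_ge0 signal_ge0 cross_noise_ge0
  signal_weight_gt0 dsetM).
Qed.

End DownlinkDuality.

Theorem corollary1 (R : realType) (Nc Nu Nb : nat)
    (Nc_gt0 : (0 < Nc)%N) (Nu_gt0 : (0 < Nu)%N) (Nb_gt0 : (0 < Nb)%N)
    (h : channels R Nc Nu Nb)
    (alpha : R) (alpha_gt0 : 0 < alpha) (alpha_le1 : alpha <= 1)
    (gamma : 'I_Nc -> 'I_Nu -> R) (gamma_gt0 : forall i u, 0 < gamma i u) :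
  primal_value alpha gamma h = dual_value alpha gamma h.
Proof.
by apply/eqP; rewrite eq_le strong_duality // weak_duality.
Qed.
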